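(* Let $X$ be a Dedekind complete Banach lattice and let $\{P_\lambda\}_{\lambda\in\Lambda}$ be a family of pairwise disjoint band projections on $X$. The inner band projections $\{\mathcal{P}_\Gamma \mid \Gamma\subseteq\Lambda\times\Lambda\}$ (respectively, the inner projection bands $\{\mathcal{B}_\Gamma\mid\Gamma\subseteq\Lambda\times\Lambda\}$) form a Boolean algebra with the same order, suprema and infima as in $\mathfrak{P}(\mathcal{L}_r(X))$ (respectively, $\mathfrak{B}(\mathcal{L}_r(X))$). Moreover, this Boolean algebra is isomorphic to $2^{\Lambda\times\Lambda}$ through the map $\Gamma\mapsto\mathcal{P}_\Gamma$ (respectively, $\Gamma\mapsto\mathcal{B}_\Gamma$).
   Context: Banach lattices are real. $\mathcal{L}_+(X)$ is the set of positive (bounded linear) operators on $X$ and $\mathcal{L}_r(X)$ its linear span; for $X$ Dedekind complete, $\mathcal{L}_r(X)$ with the regular norm is a Dedekind complete Banach lattice. A band projection on a Banach lattice $Y$ is a linear map $P\colon Y\to Y$ with $P^2=P$ and $0\le P\le I_Y$; projection bands in $Y$ are the ranges of band projections on $Y$. Band projections $P_\lambda$ are pairwise disjoint if $P_\lambda P_\mu=0$ for $\lambda\neq\mu$. For $\Gamma\subseteq\Lambda\times\Lambda$, $\mathcal{P}_\Gamma\colon\mathcal{L}_r(X)\to\mathcal{L}_r(X)$ is the unique band projection such that $\mathcal{P}_\Gamma(T)=\bigvee_{(\alpha,\beta)\in\Gamma}P_\alpha TP_\beta$ (supremum in $\mathcal{L}_r(X)$, equal to $0$ if $\Gamma=\varnothing$)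 for all $T\in\mathcal{L}_+(X)$, and $\mathcal{B}_\Gamma=\operatorname{range}(\mathcal{P}_\Gamma)$. $\mathfrak{P}(Y)$ is the Boolean algebra of band projections on $Y$ (ordered as operators, with $P\wedge Q=PQ$ and $P\vee Q=P+Q-PQ$), and $\mathfrak{B}(Y)$ is the corresponding Boolean algebra of projection bands in $Y$ (ordered by inclusion). $2^{\Lambda\times\Lambda}$ is the Boolean algebra of all subsets of $\Lambda\times\Lambda$. The Boolean algebra of the $\mathcal{P}_\Gamma$ has maximal element $\mathcal{P}_{\Lambda\times\Lambda}$, which need not be the identity $I_{\mathcal{L}_r(X)}$, so it is not claimed to be a Boolean subalgebra of $\mathfrak{P}(\mathcal{L}_r(X))$.
   Formalization: The isomorphism with the Boolean algebra of all subsets of Λ×Λ is stated only when every P_λ is nonzero, since if some P_λ = 0 the map Γ ↦ 𝒫_Γ is not injective; all other claims are for arbitrary families. *)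

(* Defs.v *)
From HB Require Import structures.
From mathcomp Require Import all_boot all_order all_algebra.
From mathcomp Require Import boolp classical_sets functions reals.
From mathcomp Require Import topology normedtype.

Set Implicit Arguments.
Unset Strict Implicit.
Unset Printing Implicit Defensive.

Import Order.TTheory GRing.Theory Num.Theory.
Import numFieldNormedType.Exports.

Local Open Scope classical_set_scope.
Local Open Scope ring_scope.

(* Ordered vector spaces carry their order as a relation of their own: a
   structure joining Order.POrder with normed modules is rejected by
   Hierarchy-Builder, since Num.NumDomain already inherits from both. *)
HB.mixin Record isOrderedLmodule (R : realType) V of GRing.Lmodule R V := {
  vle : V -> V -> Prop ;
  vle_refl : forall x, vle x x ;
  vle_anti : forall x y, vle x y -> vle y x -> x = y ;
  vle_trans : forall y x z, vle x y -> vle y z -> vle x z ;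
  vle_add2l : forall z x y, vle x y -> vle (z + x) (z + y) ;
  scalev_ge0 : forall (a : R) x, 0 <= a -> vle 0 x -> vle 0 (a *: x)
}.

#[short(type="orderedLmodType")]
HB.structure Definition OrderedLmodule (R : realType) :=
  { V of isOrderedLmodule R V & GRing.Lmodule R V }.

Notation "x <=v y" := (vle x y) (at level 70, no associativity) : ring_scope.

(* In [norm_monotone], vjoin x (- x) is the modulus |x| and `|x| is the norm. *)
HB.mixin Record isBanachLattice (R : realType) V
    of OrderedLmodule R V & CompleteNormedModule R V := {
  vjoin : V -> V -> V ;
  vmeet : V -> V -> V ;
  vjoinP : forall x y z : V, vjoin x y <=v z <-> x <=v z /\ y <=v z ;
  vmeetP : forall x y z : V, z <=v vmeet x y <-> z <=v x /\ z <=v y ;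
  norm_monotone : forall x y : V,
    vjoin x (- x) <=v vjoin y (- y) -> `|x| <= `|y|
}.

#[short(type="banachLatticeType")]
HB.structure Definition BanachLattice (R : realType) :=
  { V of isBanachLattice R V & OrderedLmodule R V & CompleteNormedModule R V }.

(* [le] is a relation on T and D : set T is regarded as a poset under [le];
   [is_sup le D F s] reads: s is the supremum, in the poset D, of F. *)
Section RelativeSup.
Context {T : Type}.
Implicit Types (le : T -> T -> Prop) (D F : set T).

Definition is_sup le D F (s : T) : Prop :=
  [/\ D s, forall x, F x -> le x s &
      forall u, D u -> (forall x, F x -> le x u) -> le s u].

Definition is_inf le D F (s : T) : Prop :=
  [/\ D s, forall x, F x -> le s x &
      forall u, D u -> (forall x, F x -> le u x) -> le u s].

Definition is_boolean_algebra le D : Prop :=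
  exists (d : Order.disp_t) (B : ctbDistrLatticeType d) (f : B -> T),
    set_bij [set: B] D f /\ forall x y, le (f x) (f y) <-> (x <= y)%O.

(* The empty family is excluded for infima only: its infimum in a poset is the
   greatest element, which D and E need not share. *)
Definition same_sup_inf le D E : Prop :=
  [/\ D `<=` E,
      forall F s, F `<=` D -> (is_sup le D F s <-> is_sup le E F s) &
      forall F s, F `<=` D -> F !=set0 ->
        (is_inf le D F s <-> is_inf le E F s)].

Definition boolean_morphism le D (d : Order.disp_t)
    (B : ctbDistrLatticeType d) (f : B -> T) : Prop :=
  [/\ forall x, D (f x),
      is_sup le D set0 (f \bot%O) /\ is_inf le D set0 (f \top%O),
      forall x y, is_sup le D [set f x; f y] (f (Order.join x y)),
      forall x y, is_inf le D [set f x; f y] (f (Order.meet x y)) &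
      forall x, is_sup le D [set f x; f (Order.compl x)] (f \top%O) /\
                is_inf le D [set f x; f (Order.compl x)] (f \bot%O)].

Definition boolean_isomorphism le D (d : Order.disp_t)
    (B : ctbDistrLatticeType d) (f : B -> T) : Prop :=
  boolean_morphism le D f /\ set_bij [set: B] D f.

End RelativeSup.

Definition dedekind_complete (R : realType) (X : orderedLmodType R) : Prop :=
  forall A : set X, A !=set0 -> (exists u, forall x, A x -> x <=v u) ->
    exists s, is_sup (@vle R X) setT A s.

Section BandProjections.
Context {R : realType} {Y : orderedLmodType R}.

Definition op_le (P Q : Y -> Y) : Prop := forall y : Y, 0 <=v y -> P y <=v Q y.

Definition band_projection : set (Y -> Y) :=
  [set P | [/\ linear P, P \o P = P, op_le (fun=> 0) P & op_le P id]].

Definition projection_band : set (set Y) :=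
  [set range P | P in band_projection].

End BandProjections.

Arguments band_projection {R} Y.
Arguments projection_band {R} Y.

Section RegularOperators.
Context {R : realType}.

Definition linear_subspace (V : lmodType R) (S : set V) : Prop :=
  S 0 /\ forall (a : R) u v, S u -> S v -> S (a *: u + v).

Variable X : banachLatticeType R.

Definition positive_operator : set (X -> X) :=
  [set T | [/\ linear T, continuous T & forall x : X, 0 <=v x -> 0 <=v T x]].

Definition regular_pred : {pred X -> X} :=
  mem (smallest (@linear_subspace (X -> X)) positive_operator).

Record regular_operator := RegularOperator {
  regular_val :> X -> X ;
  regular_valP : regular_val \in regular_pred }.

HB.instance Definition _ := [isSub for regular_val].
HB.instance Definition _ := [Choice of regular_operator by <:].

Lemma regular_submod_closed : submod_closed regular_pred.
Proof.
split=> [|a u v]; rewrite !inE; first by move=> S [[S0 _] _].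
move=> Su Sv S HS; case: (HS) => -[_ Slin] _.
by apply: Slin; [exact: Su | exact: Sv].
Qed.

HB.instance Definition _ :=
  GRing.isSubmodClosed.Build _ _ regular_pred regular_submod_closed.
HB.instance Definition _ := [SubChoice_isSubLmodule of regular_operator by <:].

Lemma regular_linear (T : regular_operator) : linear T.
Proof.
have: regular_val T \in regular_pred by exact: regular_valP.
rewrite inE; apply: smallest_sub => [|S [] //].
split=> [a u v|b f g fl gl a u v]; first by rewrite scaler0 addr0.
by rewrite !fctE/= fl gl !scalerDr !scalerA mulrC addrACA.
Qed.

Definition regular_le (S T : regular_operator) : Prop :=
  forall x : X, 0 <=v x -> S x <=v T x.

Lemma regular_le_refl T : regular_le T T.
Proof. by move=> x _; exact: vle_refl. Qed.

Lemma regular_le_trans T S U :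
  regular_le S T -> regular_le T U -> regular_le S U.
Proof. by move=> ST TU x x0; exact: vle_trans (ST x x0) (TU x x0). Qed.

Lemma regular_le_anti S T : regular_le S T -> regular_le T S -> S = T.
Proof.
move=> ST TS; apply/val_inj/funext => x.
have eq_pos (y : X) : 0 <=v y -> S y = T y.
  by move=> y0; apply: vle_anti; [exact: ST | exact: TS].
pose u : X := vjoin x 0.
have [xu u0] : x <=v u /\ 0 <=v u by apply/vjoinP; exact: vle_refl.
have ux0 : 0 <=v u - x.
  by rewrite -(addNr x) [u - x]addrC; apply: vle_add2l.
have subE (U : regular_operator) (y z : X) : U (y - z) = U y - U z.
  by rewrite -scaleN1r addrC regular_linear scaleN1r addrC.
have -> : x = u - (u - x) by rewrite opprB addrC subrK.
by rewrite /= (subE S u) (subE T u) (eq_pos u) // (eq_pos (u - x)).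
Qed.

Lemma regular_le_add2l (U S T : regular_operator) :
  regular_le S T -> regular_le (U + S) (U + T).
Proof. by move=> ST x x0; apply: vle_add2l; exact: ST. Qed.

Lemma regular_scale_ge0 (a : R) (T : regular_operator) :
  0 <= a -> regular_le 0 T -> regular_le 0 (a *: T).
Proof. by move=> a0 T0 x x0; apply: scalev_ge0 => //; exact: T0. Qed.

HB.instance Definition _ := isOrderedLmodule.Build R regular_operator
  regular_le_refl regular_le_anti regular_le_trans regular_le_add2l
  regular_scale_ge0.

End RegularOperators.

Section InnerProjections.
Context {R : realType} {X : banachLatticeType R} {L : Type}.
Variable P : L -> X -> X.

Local Notation Lr := (regular_operator X).

(* P_a T P_b is regular when P_a and P_b are band projections (these are
   positive contractions), so no member of the family is lost here. *)
Definition inner_family (G : set (L * L)) (T : Lr) : set Lr :=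
  [set S : Lr | exists a b, G (a, b) /\ S = P a \o T \o P b :> (X -> X)].

(* The supremum of the empty family is 0 by convention. *)
Definition inner_spec (G : set (L * L)) : set (Lr -> Lr) :=
  [set Q | band_projection Lr Q /\
     forall T : Lr, 0 <=v T ->
       (G = set0 -> Q T = 0) /\
       (G !=set0 ->
          is_sup (@vle R Lr) setT (inner_family G T) (Q T))].

(* Chosen by [xget]: the default, the zero map, would only be used if no band
   projection satisfied [inner_spec G]. *)
Definition inner_projection (G : set (L * L)) : Lr -> Lr :=
  xget (fun=> 0) (inner_spec G).

Definition inner_band (G : set (L * L)) : set Lr := range (inner_projection G).

End InnerProjections.

(* Main.v *)
(* Let Q_(a,b) be the operator T |-> P_a T P_b; these are pairwise disjoint
   band projections on the ordered space of regular operators. That space has a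
   generating cone and, as X is Dedekind complete, suprema of bounded directed
   sets, computed pointwise on the positive cone of X. In any such ordered space
   the finite joins of a subfamily G of pairwise disjoint band projections form a
   directed set whose pointwise supremum Q_G is a band projection, and G |-> Q_G
   turns unions into suprema and nonempty intersections into infima among all band
   projections. A band projection is determined by its range, inclusion of ranges
   being the order, so the same holds for bands. The map is injective when no
   Q_(a,b) vanishes: rank one operators f(.) x, with f a positive functional given
   by Hahn-Banach, show that Q_(a,b) <> 0 as soon as P_a and P_b are nonzero. *)
Require Import Defs.
From HB Require Import structures.
From mathcomp Require Import all_boot all_order all_algebra.
From mathcomp Require Import boolp classical_sets functions reals.
From mathcomp Require Import topology normedtype.
Import Order.TTheory GRing.Theory Num.Theory.
Import numFieldNormedType.Exports.
Local Open Scope classical_set_scope.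
Local Open Scope ring_scope.

Set Implicit Arguments.
Unset Strict Implicit.
Unset Printing Implicit Defensive.

(** * Families indexed by a powerset *)

Section PowersetFamily.
Context {T I : Type} (le : T -> T -> Prop) (E : set T) (f : set I -> T).
Hypothesis le_refl : forall x, le x x.
Hypothesis le_anti : forall x y, E x -> E y -> le x y -> le y x -> x = y.
Hypothesis f_sup : forall K : set (set I),
  is_sup le E (f @` K) (f (\bigcup_(G in K) G)).
Hypothesis f_inf : forall K : set (set I), K !=set0 ->
  is_inf le E (f @` K) (f (\bigcap_(G in K) G)).

Let fE G : E (f G).
Proof. by have [] := f_sup [set G]; rewrite bigcup_set1. Qed.

Let f_mono G H : G `<=` H -> le (f G) (f H).
Proof.
move=> GH; have [_ ub _] := f_sup [set G; H].
move: ub; rewrite bigcup_setU !bigcup_set1 (setUidr GH); apply.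
by exists G => //; left.
Qed.

Let sup_unique F s t : is_sup le E F s -> is_sup le E F t -> s = t.
Proof. by move=> [Es us ls] [Et ut lt]; apply: le_anti => //; [apply: ls|apply: lt]. Qed.

Let inf_unique F s t : is_inf le E F s -> is_inf le E F t -> s = t.
Proof. by move=> [Es us ls] [Et ut lt]; apply: le_anti => //; [apply: lt|apply: ls]. Qed.

Let range_image F : F `<=` range f -> F = f @` (f @^-1` F).
Proof.
move=> FD; apply/seteqP; split => [x Fx|_ [G FG <-]//].
by have [G _ Gx] := FD _ Fx; exists G; rewrite /preimage/= ?Gx.
Qed.

Let f_supD K : is_sup le (range f) (f @` K) (f (\bigcup_(G in K) G)).
Proof.
have [_ ub lb] := f_sup K; split=> //.
by move=> _ [G _ <-] hub; apply: lb.
Qed.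

Let f_infD K : K !=set0 ->
  is_inf le (range f) (f @` K) (f (\bigcap_(G in K) G)).
Proof.
move=> K0; have [_ ub lb] := f_inf K0.
split=> //.
by move=> _ [G _ <-] hub; apply: lb.
Qed.

(** A subset of [range f] is the image under [f] of its own preimage, so its extrema in [E] and in
    [range f] are both values of [f], and antisymmetry makes them agree. *)
Lemma powerset_family_same_sup_inf : same_sup_inf le (range f) E.
Proof.
split=> [_ [G _ <-]//|F s /range_image FE|F s /range_image FE F0].
- rewrite FE; split=> hs.
    have [Ds us ls] := hs; have [Dt ut lt] := f_supD (f @^-1` F).
    suff -> : s = f (\bigcup_(G in f @^-1` F) G) by exact: f_sup.
    have Es : E s by case: Ds => G _ <-.
    by apply: le_anti => //; [exact: ls|exact: lt].
  by rewrite (sup_unique hs (f_sup _)); exact: f_supD.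
- have K0 : (f @^-1` F) !=set0.
    have : (f @` (f @^-1` F)) !=set0 by rewrite -FE.
    by move=> [_ [G FG _]]; exists G.
  rewrite FE; split=> hs.
    have [Ds us ls] := hs; have [Dt ut lt] := f_infD K0.
    suff -> : s = f (\bigcap_(G in f @^-1` F) G) by exact: f_inf.
    have Es : E s by case: Ds => G _ <-.
    by apply: le_anti => //; [exact: lt|exact: ls].
  by rewrite (inf_unique hs (f_inf K0)); exact: f_infD.
Qed.

Let f_sup2 G H : is_sup le (range f) [set f G; f H] (f (G `|` H)).
Proof.
have := f_supD [set G; H].
by rewrite image_setU !image_set1 bigcup_setU !bigcup_set1.
Qed.

Let f_inf2 G H : is_inf le (range f) [set f G; f H] (f (G `&` H)).
Proof.
have /f_infD : [set G; H] !=set0 by exists G; left.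
by rewrite image_setU !image_set1 bigcap_setU !bigcap_set1.
Qed.

Lemma powerset_family_morphism : boolean_morphism le (range f) f.
Proof.
split=> [G|||G H|G].
- by exists G.
- split; first by have := f_supD set0; rewrite image_set0 bigcup_set0.
  (* The empty family is excluded from [f_inf], so the greatest element comes from monotonicity. *)
  by split=> // _ [G _ <-] _; exact: f_mono.
- exact: f_sup2.
- exact: f_inf2.
- by split; [have := f_sup2 G (~` G); rewrite setUCr
            |have := f_inf2 G (~` G); rewrite setICr].
Qed.

Section Support.
Variable J : set I.
Hypothesis f_supp : forall G, f (G `&` J) = f G.
Hypothesis f_reflect : forall G H, le (f G) (f H) -> G `&` J `<=` H.

(** Modelled on the powerset of [J] rather than of [I]: by [f_supp] indices outside [J] do not
    change [f], and by [f_reflect] the map is an order embedding on subsets of [J]. *)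
Lemma powerset_family_boolean : is_boolean_algebra le (range f).
Proof.
exists _, (set {i | J i}), (fun A => f [set sval x | x in A]).
have ord (A B : set {i | J i}) :
    le (f [set sval x | x in A]) (f [set sval x | x in B]) <-> A `<=` B.
  split=> [/f_reflect AB x Ax|AB]; last first.
    by apply: f_mono => _ [x Ax <-]; exists x => //; exact: AB.
  have [|y By /eq_sig_hprop <-//] := AB (sval x).
    by split; [exists x|exact: (proj2_sig x)].
split=> [|A B]; last by rewrite ord subsetEset.
split=> [A _|A B _ _ AB|_ [G _ <-]]; first by exists [set sval x | x in A].
- by apply/seteqP; split; apply/ord; rewrite AB; exact: le_refl.
- exists [set x | G (sval x)] => //; rewrite -[RHS]f_supp; congr f.
  apply/seteqP; split=> [_ [x Gx <-]|i [Gi Ji]]; first by split=> //; exact: (proj2_sig x).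
  by exists (exist _ i Ji).
Qed.

End Support.

Lemma powerset_family_isomorphism :
  (forall G H, le (f G) (f H) -> G `<=` H) ->
  boolean_isomorphism le (range f) f.
Proof.
move=> f_reflect; split; first exact: powerset_family_morphism.
split=> [G _|G H _ _ GH|_ [G _ <-]]; [by exists G| |by exists G].
by apply/seteqP; split; apply: f_reflect; rewrite GH; exact: le_refl.
Qed.

End PowersetFamily.

Lemma embedding_is_sup {T T' : Type} (le : T -> T -> Prop)
    (le' : T' -> T' -> Prop) (E F : set T) (h : T -> T') (s : T) :
  (forall x y, E x -> E y -> le' (h x) (h y) <-> le x y) ->
  F `<=` E -> is_sup le E F s -> is_sup le' (h @` E) (h @` F) (h s).
Proof.
move=> hle FE [Es us ls]; split=> [|_ [x Fx <-]|_ [u Eu <-] ub].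
- by exists s.
- by apply/hle => //; [exact: FE|exact: us].
- apply/hle => //; apply: ls => // x Fx; apply/hle => //; first exact: FE.
  by apply: ub; exists x.
Qed.

Lemma embedding_is_inf {T T' : Type} (le : T -> T -> Prop)
    (le' : T' -> T' -> Prop) (E F : set T) (h : T -> T') (s : T) :
  (forall x y, E x -> E y -> le' (h x) (h y) <-> le x y) ->
  F `<=` E -> is_inf le E F s -> is_inf le' (h @` E) (h @` F) (h s).
Proof.
move=> hle FE.
(* An infimum is a supremum for the reversed relation. *)
by apply: (@embedding_is_sup _ _ (fun x y => le y x) (fun x y => le' y x)) => // x y Ex Ey;
  exact: hle.
Qed.

(** * Ordered vector spaces *)

Section LinearFunctions.
Context {R : pzRingType} {U V : lmodType R} (f : U -> V).
Hypothesis f_lin : linear f.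

Lemma linear_fun0 : f 0 = 0.
Proof. by have := f_lin (-1) 0 0; rewrite scaler0 addr0 scaleN1r addNr. Qed.

Lemma linear_funD (x y : U) : f (x + y) = f x + f y.
Proof. by have := f_lin 1 x y; rewrite !scale1r. Qed.

Lemma linear_funZ (a : R) (x : U) : f (a *: x) = a *: f x.
Proof. by have := f_lin a x 0; rewrite linear_fun0 !addr0. Qed.

Lemma linear_funB (x y : U) : f (x - y) = f x - f y.
Proof. by rewrite -scaleN1r linear_funD linear_funZ scaleN1r. Qed.

End LinearFunctions.

Arguments linear_funD {R U V} f.
Arguments linear_funB {R U V} f.

Section OrderedLmodule.
Context {R : realType} {Y : orderedLmodType R}.
Implicit Types (x y z : Y) (f g S : Y -> Y).

Lemma vleD x y z t : x <=v y -> z <=v t -> x + z <=v y + t.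
Proof.
move=> xy zt; apply: (vle_trans _ _ _ (vle_add2l x _ _ zt)).
by rewrite ![_ + t]addrC; exact: vle_add2l.
Qed.

Lemma subv_ge0 x y : 0 <=v y - x <-> x <=v y.
Proof.
split=> h; last by rewrite -(addNr x) [y - x]addrC; exact: vle_add2l.
by rewrite -[x]addr0 -[y](subrKC x); exact: vle_add2l.
Qed.

Lemma addv_ge0 x y : 0 <=v x -> 0 <=v y -> 0 <=v x + y.
Proof. by move=> x0 y0; rewrite -[0]addr0; exact: vleD. Qed.

Lemma vleZ (a : R) x y : 0 <= a -> x <=v y -> a *: x <=v a *: y.
Proof.
by move=> a0 /subv_ge0 xy; apply/subv_ge0; rewrite -scalerBr; exact: scalev_ge0.
Qed.

Lemma vle_sup_unique (A : set Y) s t :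
  is_sup (@vle R Y) setT A s -> is_sup (@vle R Y) setT A t -> s = t.
Proof.
by move=> [_ us ls] [_ ut lt]; apply: vle_anti; [exact: ls|exact: lt].
Qed.

Definition generating_cone := forall y, exists u v,
  [/\ 0 <=v u, 0 <=v v & y = u - v].

(** Directedness keeps pointwise suprema of linear maps additive, so this form of completeness
    passes from a Banach lattice to its regular operators. *)
Definition directed_complete := forall A : set Y, A !=set0 ->
  (forall x y, A x -> A y -> exists z, [/\ A z, x <=v z & y <=v z]) ->
  (exists u, forall x, A x -> x <=v u) ->
  exists s, is_sup (@vle R Y) setT A s.

Lemma positive_linear_homo f x y :
  linear f -> op_le (fun=> 0) f -> x <=v y -> f x <=v f y.
Proof.
move=> fl f0 /subv_ge0 xy; apply/subv_ge0; rewrite -linear_funB//; exact: f0.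
Qed.

Hypothesis Y_gen : generating_cone.

Lemma linear_eq_on_cone f g :
  linear f -> linear g -> (forall y, 0 <=v y -> f y = g y) -> f = g.
Proof.
move=> fl gl fg; apply/funext => y; have [u [v [u0 v0 ->]]] := Y_gen y.
by rewrite !linear_funB// !fg.
Qed.

(** The value at [u - v] must be [s u - s v]; additivity makes this independent of the
    decomposition, and a negative scalar exchanges the two parts. *)
Lemma cone_linear_extension (s : Y -> Y) :
  (forall x y, 0 <=v x -> 0 <=v y -> s (x + y) = s x + s y) ->
  (forall (a : R) x, 0 <= a -> 0 <=v x -> s (a *: x) = a *: s x) ->
  exists2 f : Y -> Y, linear f & forall x, 0 <=v x -> f x = s x.
Proof.
move=> sD sZ.
have /choice[p] : forall y, exists uv : Y * Y,
    [/\ 0 <=v uv.1, 0 <=v uv.2 & y = uv.1 - uv.2].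
  by move=> y; have [u [v ?]] := Y_gen y; exists (u, v).
move=> pP; pose f y := s (p y).1 - s (p y).2.
have fE u v : 0 <=v u -> 0 <=v v -> f (u - v) = s u - s v.
  move=> u0 v0; have [p0 q0 pq] := pP (u - v); rewrite /f.
  move: (p (u - v)) p0 q0 pq => [a b]/= a0 b0 uvab.
  apply/eqP; rewrite subr_eq addrAC eq_sym subr_eq -!sD//; apply/eqP; congr s.
  by apply/eqP; rewrite -subr_eq addrAC uvab subrK.
exists f => [a x y|x x0]; last first.
  rewrite -{1}[x]subr0 fE //; last exact: vle_refl.
  by rewrite -(scale0r x) sZ // scale0r subr0.
have [u [v [u0 v0 ->]]] := Y_gen x; have [z [t [z0 t0 ->]]] := Y_gen y.
rewrite !fE//; have [a0|/ltW a0] := leP 0 a.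
  have -> : a *: (u - v) + (z - t) = (a *: u + z) - (a *: v + t).
    by rewrite scalerBr opprD addrACA.
  rewrite fE ?sD ?sZ//; try exact: scalev_ge0; last 2 first.
  - by apply: addv_ge0 => //; exact: scalev_ge0.
  - by apply: addv_ge0 => //; exact: scalev_ge0.
  by rewrite scalerBr opprD addrACA.
have Na0 : 0 <= - a by rewrite oppr_ge0.
have -> : a *: (u - v) + (z - t) = ((- a) *: v + z) - ((- a) *: u + t).
  by rewrite scalerBr opprD [RHS]addrACA !scaleNr opprK [- _ + a *: u]addrC.
rewrite fE ?sD ?sZ//; try exact: scalev_ge0; last 2 first.
- by apply: addv_ge0 => //; exact: scalev_ge0.
- by apply: addv_ge0 => //; exact: scalev_ge0.
by rewrite scalerBr opprD [LHS]addrACA !scaleNr opprK [- _ + a *: s u]addrC.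
Qed.

Hypothesis Y_dc : directed_complete.

Lemma directed_sup_linear (A : set (Y -> Y)) (U : Y -> Y) :
  A !=set0 -> (forall f, A f -> linear f) ->
  (forall f g, A f -> A g -> exists h, [/\ A h, op_le f h & op_le g h]) ->
  (forall f, A f -> op_le f U) ->
  exists2 S : Y -> Y, linear S & forall x, 0 <=v x ->
    is_sup (@vle R Y) setT [set f x | f in A] (S x).
Proof.
move=> [f0 Af0] A_lin A_dir A_ub.
have /choice[s sP] : forall x, exists s, 0 <=v x ->
    is_sup (@vle R Y) setT [set f x | f in A] s.
  move=> x; have [x0|nx0] := pselect (0 <=v x); last by exists 0.
  have [|||s sP] := @Y_dc [set f x | f in A]; last by exists s.
  - by exists (f0 x); exists f0.
  - move=> _ _ [f Af <-] [g Ag <-]; have [h [Ah fh gh]] := A_dir f g Af Ag.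
    by exists (h x); split; [exists h|exact: fh|exact: gh].
  - by exists (U x) => _ [f Af <-]; exact: A_ub.
have [x y x0 y0|a x|S Sl Ss] := @cone_linear_extension s; last first.
- by exists S => // x x0; rewrite Ss//; exact: sP.
- rewrite le_eqVlt => /predU1P[<-{a}|a0] x0.
    have [_ us ls] := sP _ (vle_refl (0 : Y)).
    rewrite !scale0r; apply: vle_anti.
      by apply: ls => // _ [f Af <-]; rewrite linear_fun0; [exact: vle_refl|exact: A_lin].
    by apply: us; exists f0 => //; rewrite linear_fun0//; exact: A_lin.
  have [_ us ls] := sP x x0.
  apply: (@vle_sup_unique [set f (a *: x) | f in A]).
    by apply: sP; apply: scalev_ge0 => //; exact: ltW.
  split=> // [_ [f Af <-]|u _ ub].
    rewrite linear_funZ; last exact: A_lin.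
    by apply: vleZ; [exact: ltW|apply: us; exists f].
  rewrite -[u](scalerKV (lt0r_neq0 a0)).
  apply: vleZ; first exact: ltW.
  apply: ls => // _ [f Af <-].
  rewrite -[f x](scalerK (lt0r_neq0 a0)).
  apply: vleZ; first by rewrite invr_ge0 ltW.
  by rewrite -(linear_funZ (A_lin f Af)); apply: ub; exists f.
- have [_ ux lx] := sP x x0; have [_ uy ly] := sP y y0.
  apply: (@vle_sup_unique [set f (x + y) | f in A]).
    exact/sP/addv_ge0.
  split=> // [_ [f Af <-]|u _ ub].
    rewrite linear_funD; last exact: A_lin.
    by apply: vleD; [apply: ux|apply: uy]; exists f.
  (* The suprema are removed one at a time: first [s x <=v u - s y] is reduced to each [f x], then
     [s y <=v u - f x] to each [g y]. A common upper bound [h] of [f] and [g] in [A] concludes. *)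
  apply/subv_ge0; rewrite opprD addrA addrAC; apply/subv_ge0.
  apply: lx => // _ [f Af <-].
  apply/subv_ge0; rewrite addrAC; apply/subv_ge0.
  apply: ly => // _ [g Ag <-].
  have [h [Ah fh gh]] := A_dir f g Af Ag.
  have : h x + h y <=v u.
    by rewrite -(linear_funD h (A_lin h Ah)); apply: ub; exists h.
  move=> hu; apply/subv_ge0; rewrite -addrA -opprD; apply/subv_ge0.
  by apply: (vle_trans _ _ _ _ hu); apply: vleD; [exact: fh|exact: gh].
Qed.

End OrderedLmodule.

Arguments generating_cone {R} Y.
Arguments directed_complete {R} Y.

(** * Band projections *)

Section BandProjectionFacts.
Context {R : realType} {Y : orderedLmodType R}.
Implicit Types (x y z : Y) (B C : Y -> Y).

Lemma band_projection_ge0 B y : band_projection Y B -> 0 <=v y -> 0 <=v B y.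
Proof. by move=> [_ _ B0 _]; exact: B0. Qed.

Lemma band_projection_homo B x y :
  band_projection Y B -> x <=v y -> B x <=v B y.
Proof. by move=> [Bl _ B0 _]; exact: positive_linear_homo. Qed.

Lemma band_projection_idem B y : band_projection Y B -> B (B y) = B y.
Proof. by move=> [_ BB _ _]; rewrite -[in RHS]BB. Qed.

Lemma band_projection0 : band_projection Y (fun=> 0).
Proof.
split=> // [a x y|x _]; first by rewrite scaler0 addr0.
exact: vle_refl.
Qed.

Lemma op_leP_absorb B C : band_projection Y B -> band_projection Y C ->
  (forall y, C (B y) = B y) -> op_le B C.
Proof.
move=> [_ _ _ BI] Cb CB y y0; rewrite -CB.
by apply: band_projection_homo => //; exact: BI.
Qed.

Hypothesis Y_gen : generating_cone Y.

(** On the cone, [B u = B (B u) <=v C (B u) <=v B u]; the equality extends because the cone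
    generates. *)
Lemma op_le_absorb B C : band_projection Y B -> band_projection Y C ->
  op_le B C -> forall y, C (B y) = B y.
Proof.
move=> Bb Cb BC y.
have [Bl _ _ _] := Bb; have [Cl _ _ CI] := Cb.
suff /(congr1 (@^~ y)) : C \o B = B by [].
apply: (linear_eq_on_cone Y_gen) => // [a u v|u u0] /=; first by rewrite Bl Cl.
apply: vle_anti; first by apply: CI; exact: band_projection_ge0.
rewrite -{1}(band_projection_idem _ Bb) //.
by apply: BC; exact: band_projection_ge0.
Qed.

Lemma op_le_anti B C : band_projection Y B -> band_projection Y C ->
  op_le B C -> op_le C B -> B = C.
Proof.
move=> [Bl _ _ _] [Cl _ _ _] BC CB; apply: (linear_eq_on_cone Y_gen) => // y y0.
by apply: vle_anti; [exact: BC|exact: CB].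
Qed.

(** Both sides amount to [C] fixing every [B y]. *)
Lemma range_subset_op_le B C : band_projection Y B -> band_projection Y C ->
  range B `<=` range C <-> op_le B C.
Proof.
move=> Bb Cb; split=> [BC|BC _ [y _ <-]].
  apply: op_leP_absorb => // y.
  have [z _ <-] : range C (B y) by apply: BC; exists y.
  exact: band_projection_idem.
by exists (B y) => //; exact: op_le_absorb.
Qed.

End BandProjectionFacts.

(** * Suprema of families of pairwise disjoint band projections *)

Section FiniteJoins.
Context {R : realType} {Y : orderedLmodType R} {I : Type} (Q : I -> Y -> Y).
Implicit Types (x y : Y) (G H : set I) (S : Y -> Y) (K : set (set I)).

(* The joins of finitely many members of Q indexed by G: when S and Q i commute,
   Q i + S (1 - Q i) is their join in the Boolean algebra of band projections. *)
Inductive finite_join G : set (Y -> Y) :=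
| finite_join0 : finite_join G (fun=> 0)
| finite_joinU i S : G i -> finite_join G S ->
    finite_join G (fun y => Q i y + S (y - Q i y)).

Lemma finite_join_subset G H : G `<=` H -> finite_join G `<=` finite_join H.
Proof.
move=> GH S; elim=> {S} [|i S Gi _ IH]; first exact: finite_join0.
by apply: finite_joinU => //; exact: GH.
Qed.

Hypothesis Y_gen : generating_cone Y.
Hypothesis Q_band : forall i, band_projection Y (Q i).
Hypothesis Q_disj : forall i j, i <> j -> forall y, Q i (Q j y) = 0.

Let Q_comm i j y : Q i (Q j y) = Q j (Q i y).
Proof.
by have [->//|ij] := pselect (i = j); rewrite !Q_disj//; exact: nesym.
Qed.

Let Q_idem i y : Q i (Q i y) = Q i y.
Proof. exact: band_projection_idem. Qed.

Let Q_lin i : linear (Q i). Proof. by have [] := Q_band i. Qed.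

Let Q_compl_ge0 i y : 0 <=v y -> 0 <=v y - Q i y.
Proof. by move=> y0; apply/subv_ge0; have [_ _ _] := Q_band i; exact. Qed.


Let Q_complK i y : Q i (y - Q i y) = 0.
Proof. by rewrite linear_funB// Q_idem subrr. Qed.

(** Commutation with every [Q i] is carried through the induction, since it is what makes the next
    join idempotent. *)
Lemma finite_join_band G S : finite_join G S ->
  band_projection Y S /\ forall i y, S (Q i y) = Q i (S y).
Proof.
elim=> {S} [|i S Gi _ [Sb SQ]].
  split; first exact: band_projection0.
  by move=> i y; rewrite linear_fun0.
have [Sl _ S0 SI] := Sb.
split; last first.
  move=> j y; rewrite (linear_funD (Q j))// (Q_comm j) -SQ.
  by rewrite (linear_funB (Q j))// (Q_comm j).
split=> [a x y||y y0|y y0] /=.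
- by rewrite Q_lin opprD addrACA -scalerBr Sl addrACA -scalerDr.
- apply/funext => y /=.
  rewrite (linear_funD (Q i))// -SQ Q_complK linear_fun0// addr0 Q_idem.
  by rewrite addrAC subrr add0r band_projection_idem.
- by apply: addv_ge0; [exact: band_projection_ge0|exact/S0/Q_compl_ge0].
- rewrite -[X in _ <=v X](subrKC (Q i y)); apply: vle_add2l.
  exact/SI/Q_compl_ge0.
Qed.

Lemma finite_join_le G S B : band_projection Y B ->
  (forall i, G i -> op_le (Q i) B) -> finite_join G S -> op_le S B.
Proof.
move=> Bb QB GS; have [Sb _] := finite_join_band GS.
apply: op_leP_absorb => //; have [Bl _ _ _] := Bb.
elim: GS => {S Sb} [|i S Gi _ IH] y; first exact: linear_fun0.
by rewrite (linear_funD B)// IH (op_le_absorb Y_gen (Q_band i) Bb (QB i Gi)).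
Qed.

(** The members that build [S'] are adjoined one by one to [S]; each step enlarges the join because
    [V (Q i y) <=v Q i y] on the cone. *)
Lemma finite_join_directed G S S' : finite_join G S -> finite_join G S' ->
  exists V, [/\ finite_join G V, op_le S V & op_le S' V].
Proof.
move=> GS; elim=> {S'} [|i S' Gi GS' [V [GV SV S'V]]].
  exists S; split=> //; first by move=> y _; exact: vle_refl.
  by move=> y; apply: band_projection_ge0; have [] := finite_join_band GS.
have [Vb VQ] := finite_join_band GV; have [Vl _ V0 VI] := Vb.
exists (fun y => Q i y + V (y - Q i y)); split=> [|y y0|y y0].
- exact: finite_joinU.
- apply: (vle_trans _ _ _ (SV _ y0)).
  rewrite -{1}(subrKC (Q i y) y) (linear_funD V)//.
  rewrite ![_ + V (_ - _)]addrC; apply: vle_add2l.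
  exact/VI/band_projection_ge0.
- by apply: vle_add2l; exact/S'V/Q_compl_ge0.
Qed.

Lemma finite_join_disj G S i y : ~ G i -> finite_join G S -> S (Q i y) = 0.
Proof.
move=> nGi GS; elim: GS y => {S} [//|j S Gj GS IH] y.
have [[Sl _ _ _] _] := finite_join_band GS.
have ji : j <> i by move=> ji; apply: nGi; rewrite -ji.
by rewrite Q_disj// subr0 IH addr0.
Qed.

(* Since S and Q i commute, S (1 - Q i) u >= S (1 - Q i) y follows from S u >= S y. *)
Lemma finite_join_le_bound G S y u : 0 <=v u ->
  (forall i, G i -> Q i y <=v u) -> finite_join G S -> S y <=v u.
Proof.
move=> u0 yu GS; have [[_ _ _ SI] _] := finite_join_band GS.
apply: (vle_trans (S u)); last exact: SI.
elim: GS {SI} => {S} [|i S Gi GS IH]; first exact: vle_refl.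
have [[Sl _ _ _] SQ] := finite_join_band GS.
apply: vleD.
  by rewrite -Q_idem; apply: band_projection_homo => //; exact: yu.
rewrite !linear_funB// !SQ; apply/subv_ge0.
rewrite opprD addrACA -opprD -(linear_funB (Q i))//.
exact/Q_compl_ge0/subv_ge0.
Qed.

Hypothesis Y_dc : directed_complete Y.

(** The identity bounds all finite joins, so their pointwise supremum [B] is linear and lies between
    0 and the identity. Idempotence comes from [S y = S (S y) <=v S (B y) <=v B (B y)]. *)
Lemma band_sup_exists G : exists2 B, band_projection Y B &
  forall y, 0 <=v y -> is_sup (@vle R Y) setT [set S y | S in finite_join G] (B y).
Proof.
have [||||B Bl Bsup] := @directed_sup_linear _ _ Y_gen Y_dc (finite_join G) id.
- by exists (fun=> 0); exact: finite_join0.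
- by move=> S /finite_join_band[[]].
- by move=> S S'; exact: finite_join_directed.
- by move=> S /finite_join_band[[]].
exists B => //.
have B0 y : 0 <=v y -> 0 <=v B y.
  by move=> /Bsup[_ + _]; apply; exists (fun=> 0) => //; exact: finite_join0.
have BI y : 0 <=v y -> B y <=v y.
  move=> y0; have [_ _] := Bsup _ y0; apply=> // _ [S GS <-].
  by have [[_ _ _ SI] _] := finite_join_band GS; exact: SI.
split=> //; apply: (linear_eq_on_cone Y_gen) => // [a x y /=|y y0 /=].
  by rewrite !Bl.
apply: vle_anti; first exact/BI/B0.
have [_ ub lb] := Bsup _ y0; apply: lb => // _ [S GS <-].
have [Sb _] := finite_join_band GS.
rewrite -(band_projection_idem y Sb).
apply: (vle_trans (S (B y))).
  by apply: band_projection_homo => //; apply: ub; exists S.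
by have [_ + _] := Bsup _ (B0 _ y0); apply; exists S.
Qed.

Definition band_sup G : Y -> Y := sval (cid2 (band_sup_exists G)).

Lemma band_sup_band G : band_projection Y (band_sup G).
Proof. by rewrite /band_sup; case: cid2. Qed.

Lemma band_supP G y : 0 <=v y ->
  is_sup (@vle R Y) setT [set S y | S in finite_join G] (band_sup G y).
Proof. by rewrite /band_sup; case: cid2 => /= B _; exact. Qed.

Let finite_join_le_band_sup G S : finite_join G S -> op_le S (band_sup G).
Proof. by move=> GS y y0; have [_ + _] := band_supP G y0; apply; exists S. Qed.

Lemma band_sup_mono G H : G `<=` H -> op_le (band_sup G) (band_sup H).
Proof.
move=> GH y y0; have [_ _] := band_supP G y0; apply=> // _ [S GS <-].
by apply: finite_join_le_band_sup => //; exact: finite_join_subset GS.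
Qed.

Lemma band_sup_le G B : band_projection Y B ->
  (forall i, G i -> op_le (Q i) B) -> op_le (band_sup G) B.
Proof.
move=> Bb GB y y0; have [_ _] := band_supP G y0; apply=> // _ [S GS <-].
exact: (finite_join_le Bb GB GS).
Qed.

Lemma le_band_sup G i : G i -> op_le (Q i) (band_sup G).
Proof.
move=> Gi y y0; have := finite_joinU Gi (finite_join0 G).
by move=> /finite_join_le_band_sup /(_ y y0); rewrite addr0.
Qed.

(** A finite join [S] over [G] kills [Q i y], so [S y = S (y - Q i y) <=v y - Q i y] for positive
    [y]; the bound passes to the supremum, and [Q i] annihilates it. *)
Lemma band_sup_disj G i : ~ G i -> forall y, Q i (band_sup G y) = 0.
Proof.
move=> nGi y; have [Bl _ _ _] := band_sup_band G.
suff /(congr1 (@^~ y)) : Q i \o band_sup G = fun=> 0 by [].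
apply: (linear_eq_on_cone Y_gen) => // {y} [a x y /=|a x y|y y0 /=].
- by rewrite Bl Q_lin.
- by rewrite scaler0 addr0.
apply: vle_anti; last first.
  by apply: band_projection_ge0 => //; apply: band_projection_ge0 => //; exact: band_sup_band.
rewrite -(Q_complK i y); apply: band_projection_homo => //.
have [_ _] := band_supP G y0; apply=> // _ [S GS <-].
have [[Sl _ _ SI] _] := finite_join_band GS.
rewrite -[S y]subr0 -(finite_join_disj y nGi GS) -linear_funB//.
exact/SI/Q_compl_ge0.
Qed.

Lemma band_sup_bigcup K :
  is_sup op_le (band_projection Y) (band_sup @` K) (band_sup (\bigcup_(G in K) G)).
Proof.
split=> [|_ [G KG <-]|B Bb ub]; first exact: band_sup_band.
  by apply: band_sup_mono; exact: bigcup_sup.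
apply: band_sup_le => // i [G KG Gi] y y0.
apply: (vle_trans _ _ _ (le_band_sup Gi y0)).
by apply: ub => //; exists G.
Qed.

(** A lower bound [B] is absorbed by [band_sup G] for each [G] in [K]. With [G0] in [K], finite
    joins over [G0] agree on the range of [B] with finite joins over the intersection, so [B y] is
    at most the claimed infimum at [B y], hence at [y]. *)
Lemma band_sup_bigcap K : K !=set0 ->
  is_inf op_le (band_projection Y) (band_sup @` K) (band_sup (\bigcap_(G in K) G)).
Proof.
move=> [G0 KG0]; split=> [|_ [G KG <-]|B Bb lb]; first exact: band_sup_band.
  by apply: band_sup_mono; exact: bigcap_inf.
have absorb G y : K G -> band_sup G (B y) = B y.
  move=> KG; apply: op_le_absorb => //; first exact: band_sup_band.
  by apply: lb; exists G.
(* On the range of B, the members of G0 outside the intersection vanish. *)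
have restrict S : finite_join G0 S -> exists2 S',
    finite_join (\bigcap_(G in K) G) S' & forall y, S (B y) = S' (B y).
  elim=> {S} [|i S G0i GS [S' GS' SS']].
    by exists (fun=> 0) => //; exact: finite_join0.
  have [[Sl _ _ _] SQ] := finite_join_band GS.
  have [[Sl' _ _ _] SQ'] := finite_join_band GS'.
  have [Vi|nVi] := pselect ((\bigcap_(G in K) G) i).
    exists (fun y => Q i y + S' (y - Q i y)); first exact: finite_joinU.
    by move=> y; rewrite (linear_funB S)// (linear_funB S')// SQ SQ' SS'.
  exists S' => // y.
  have [G /not_implyP[KG nGi]] : exists G, ~ (K G -> G i) by exact/existsNP.
  have -> : Q i (B y) = 0 by rewrite -(absorb _ _ KG) band_sup_disj.
  by rewrite subr0 add0r.
move=> y y0; have By0 := band_projection_ge0 Bb y0.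
apply: (vle_trans (band_sup (\bigcap_(G in K) G) (B y))); last first.
  apply: band_projection_homo; first exact: band_sup_band.
  by have [_ _ _] := Bb; exact.
rewrite -{1}(absorb _ y KG0).
have [_ _] := band_supP G0 By0; apply=> // _ [S GS <-].
have [S' GS' ->] := restrict _ GS; exact: finite_join_le_band_sup.
Qed.

Lemma band_sup_support G : band_sup (G `&` [set i | Q i <> fun=> 0]) = band_sup G.
Proof.
apply: (op_le_anti Y_gen); try exact: band_sup_band.
  by apply: band_sup_mono => i [].
apply: band_sup_le => [|i Gi]; first exact: band_sup_band.
have [Qi0|Qi0] := pselect (Q i = fun=> 0); last exact: le_band_sup.
by rewrite Qi0 => y; apply: band_projection_ge0; exact: band_sup_band.
Qed.

(** For [i] in [G] but not in [H] and [y] positive, [Q i y = Q i (Q i y) <=v Q i (band_sup H y) =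
    0], so [Q i] vanishes. *)
Lemma band_sup_reflect G H : op_le (band_sup G) (band_sup H) ->
  G `&` [set i | Q i <> fun=> 0] `<=` H.
Proof.
move=> GH i [Gi]; apply: contrapT => /not_implyP[Qi0 nHi]; apply: Qi0.
apply: (linear_eq_on_cone Y_gen) => // [a x y|y y0]; first by rewrite scaler0 addr0.
apply: vle_anti; last exact: band_projection_ge0.
rewrite -Q_idem -(band_sup_disj nHi y); apply: band_projection_homo => //.
by apply: (vle_trans _ _ _ (le_band_sup Gi y0)); exact: GH.
Qed.

(** Passes from the finite joins to the [Q i] themselves, as [inner_spec] demands; a member of [G]
    shows that an upper bound [u] is positive, which [finite_join_le_bound] needs. *)
Lemma band_sup_sup G y : G !=set0 -> 0 <=v y ->
  is_sup (@vle R Y) setT [set Q i y | i in G] (band_sup G y).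
Proof.
move=> [i Gi] y0; split=> // [_ [j Gj <-]|u _ ub]; first exact: le_band_sup.
have [_ _] := band_supP G y0; apply=> // _ [S GS <-].
apply: finite_join_le_bound GS => [|j Gj]; last by apply: ub; exists j.
apply: (vle_trans (Q i y)); first exact: band_projection_ge0.
by apply: ub; exists i.
Qed.

Lemma band_sup_set0 : band_sup set0 = fun=> 0.
Proof.
apply: (op_le_anti Y_gen); [exact: band_sup_band|exact: band_projection0| |].
  by apply: band_sup_le => //; exact: band_projection0.
by move=> y; apply: band_projection_ge0; exact: band_sup_band.
Qed.

End FiniteJoins.

(** * Regular operators *)

Section BanachLatticeFacts.
Context {R : realType} {X : banachLatticeType R}.
Implicit Types (x y : X) (S T : regular_operator X).

Lemma vjoin_ub x y : x <=v vjoin x y /\ y <=v vjoin x y.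
Proof. by apply/vjoinP; exact: vle_refl. Qed.

Lemma banach_lattice_generating : generating_cone X.
Proof.
move=> x; have [x0 u0] := vjoin_ub x 0.
exists (vjoin x 0), (vjoin x 0 - x); split=> //; last by rewrite opprB subrKC.
exact/subv_ge0.
Qed.

Lemma dedekind_complete_directed : dedekind_complete X -> directed_complete X.
Proof. by move=> Xdc A A0 _ Aub; exact: Xdc. Qed.

Local Notation vabs x := (vjoin x (- x)).

Lemma vabs_ge0 x : 0 <=v vabs x.
Proof.
have [xx Nxx] := vjoin_ub x (- x).
have : 0 <=v (2^-1 : R) *: (vabs x + vabs x).
  apply: scalev_ge0; first by rewrite invr_ge0.
  by rewrite -(subrr x); exact: vleD.
by rewrite scalerDr -scalerDl -[2^-1]mul1r -splitr scale1r.
Qed.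

Lemma norm_vabs x : `|vabs x| = `|x|.
Proof.
have NN y : 0 <=v y -> - y <=v y.
  by move=> y0; apply: (vle_trans 0) => //; apply/subv_ge0; rewrite opprK add0r.
apply/eqP; rewrite eq_le; apply/andP; split; apply: norm_monotone.
  by apply/vjoinP; split; [exact: vle_refl|exact/NN/vabs_ge0].
by have [] := vjoin_ub (vabs x) (- vabs x).
Qed.

Lemma norm_le_vabs x y : vabs x <=v y -> `|x| <= `|y|.
Proof.
move=> xy; apply: norm_monotone; apply: (vle_trans _ _ _ xy).
by have [] := vjoin_ub y (- y).
Qed.

(** Both [S x] and [S (- x)] lie below [S] of the modulus of [x], hence below [T] of it, so a norm
    bound for [T] serves for [S]. *)
Lemma dominated_continuous (S T : X -> X) : linear S -> linear T ->
  (forall x, 0 <=v x -> 0 <=v S x) -> (forall x, 0 <=v x -> S x <=v T x) ->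
  continuous T -> continuous S.
Proof.
move=> Sl Tl S0 ST Tc.
pose Slin : {linear X -> X} := HB.pack S (GRing.isLinear.Build R X X _ S Sl).
pose Tlin : {linear X -> X} := HB.pack T (GRing.isLinear.Build R X X _ T Tl).
have /linear_boundedP[r [rr Tr]] : bounded_near Tlin (nbhs (0 : X)).
  by apply: continuous_linear_bounded; exact: Tc.
apply: (@bounded_linear_continuous R X X Slin).
apply/linear_boundedP; exists r; split=> // M rM x.
apply: (le_trans (y := `|T (vabs x)|)); last first.
  by rewrite -(norm_vabs x); exact: Tr.
apply: norm_le_vabs; apply: (vle_trans _ _ _ _ (ST _ (vabs_ge0 x))).
have [xx Nxx] := vjoin_ub x (- x).
apply/vjoinP; split; first exact: positive_linear_homo.
have -> : - Slin x = S (- x) by rewrite -[- x]sub0r (linear_funB S)// linear_fun0// sub0r.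
exact: positive_linear_homo.
Qed.

Lemma positive_operatorD (S T : X -> X) :
  positive_operator S -> positive_operator T -> positive_operator (S + T).
Proof.
move=> [Sl Sc S0] [Tl Tc T0]; split=> [a x y|x|x x0].
- by rewrite !fctE /= Sl Tl scalerDr addrACA.
- by apply: cvgD; [exact: Sc|exact: Tc].
- by apply: addv_ge0; [exact: S0|exact: T0].
Qed.

Lemma positive_operatorZ (a : R) (T : X -> X) :
  0 <= a -> positive_operator T -> positive_operator (a *: T).
Proof.
move=> a0 [Tl Tc T0]; split=> [b x y|x|x x0].
- by rewrite !fctE /= Tl scalerDr !scalerA mulrC.
- by apply: cvgZr; exact: Tc.
- by apply: scalev_ge0 => //; exact: T0.
Qed.

Lemma positive_operator_regular (T : X -> X) :
  positive_operator T -> T \in @regular_pred R X.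
Proof. by move=> T0; rewrite inE => S [_]; exact. Qed.

Lemma regular_ind (M : set (X -> X)) T :
  linear_subspace M -> @positive_operator R X `<=` M -> M T.
Proof.
move=> HM posM; have : regular_val T \in @regular_pred R X by exact: regular_valP.
by rewrite inE => /(_ M); exact.
Qed.

Lemma regular_continuous T : continuous T.
Proof.
apply: (@regular_ind [set S | continuous S]) => [|S []//].
split=> [|a u v uc vc] x; first exact: cvg_cst.
by apply: cvgD; [apply: cvgZr; exact: uc|exact: vc].
Qed.

Lemma zero_positive_operator : positive_operator (0 : X -> X).
Proof.
split=> [a x y|x|x _]; first by rewrite scaler0 addr0.
  exact: cvg_cst.
exact: vle_refl.
Qed.

(** Differences of positive operators form a linear subspace, a negative scalar exchanging the two
    terms. *)
Lemma regular_diff T : exists A B : X -> X,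
  [/\ positive_operator A, positive_operator B & regular_val T = A - B].
Proof.
have pos0 := zero_positive_operator.
apply: (@regular_ind [set S | exists A B : X -> X,
  [/\ positive_operator A, positive_operator B & S = A - B]]) => [|S S0]; last first.
  by exists S, 0; rewrite subr0.
split=> [|a _ _ [A [B [A0 B0 ->]]] [C [D [C0 D0 ->]]]].
  by exists 0, 0; rewrite subr0.
have [a0|/ltW a0] := leP 0 a.
  exists (a *: A + C), (a *: B + D).
  split; try by apply: positive_operatorD => //; exact: positive_operatorZ.
  by rewrite scalerBr opprD addrACA.
have Na0 : 0 <= - a by rewrite oppr_ge0.
exists ((- a) *: B + C), ((- a) *: A + D).
split; try by apply: positive_operatorD => //; exact: positive_operatorZ.
by rewrite !scaleNr scalerBr opprD opprK [RHS]addrACA [- _ + a *: A]addrC.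
Qed.

Lemma regular_generating : generating_cone (regular_operator X).
Proof.
move=> T; have [A [B [A0 B0 TAB]]] := regular_diff T.
exists (RegularOperator (positive_operator_regular A0)),
  (RegularOperator (positive_operator_regular B0)).
split; [by case: A0|by case: B0|exact/val_inj].
Qed.

Lemma dominated_regular (S : X -> X) T : linear S ->
  (forall x, 0 <=v x -> 0 <=v S x) -> (forall x, 0 <=v x -> S x <=v T x) ->
  S \in @regular_pred R X.
Proof.
move=> Sl S0 ST; apply: positive_operator_regular; split=> //.
apply: (dominated_continuous Sl _ S0 ST); [exact: regular_linear|exact: regular_continuous].
Qed.

Lemma regular_directed_complete :
  dedekind_complete X -> directed_complete (regular_operator X).
Proof.
move=> Xdc A [T0 AT0] A_dir [U AU].
have [||||S Sl Ssup] := @directed_sup_linear _ _ banach_lattice_generating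
    (dedekind_complete_directed Xdc) (@regular_val R X @` A) U.
- by exists T0; exists T0.
- by move=> _ [T _ <-]; exact: regular_linear.
- move=> _ _ [T AT <-] [T' AT' <-]; have [V [AV TV T'V]] := A_dir _ _ AT AT'.
  by exists V; split; [exists V|exact: TV|exact: T'V].
- by move=> _ [T AT <-]; exact: AU.
have ub T x : A T -> 0 <=v x -> T x <=v S x.
  by move=> AT x0; have [_ + _] := Ssup _ x0; apply; exists (regular_val T) => //; exists T.
have Sreg : S \in @regular_pred R X.
  (* Subtracting a member [T0] of [A] makes the supremum positive and dominated by the regular
     operator [U - T0]. *)
  have -> : S = (S - T0 : X -> X) + T0 by rewrite subrK.
  apply: rpredD; last exact: regular_valP.
  apply: (@dominated_regular _ (U - T0)) => [a x y|x x0|x x0].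
  - change (S (a *: x + y) - T0 (a *: x + y) = a *: (S x - T0 x) + (S y - T0 y)).
    by rewrite Sl regular_linear opprD scalerBr addrACA.
  - by apply/subv_ge0; exact: ub.
  - change (S x - T0 x <=v U x - T0 x).
    rewrite ![_ - T0 x]addrC; apply: vle_add2l.
    by have [_ _] := Ssup _ x0; apply=> // _ [_ [T AT <-] <-]; exact: AU.
exists (RegularOperator Sreg); split=> // [T AT x|V _ VA x x0]; first exact: ub.
by have [_ _] := Ssup _ x0; apply=> // _ [_ [T AT <-] <-]; exact: VA.
Qed.

(** * Two-sided multiplication by band projections *)

Section Sandwich.
Context {B C : X -> X} (B_band : band_projection X B) (C_band : band_projection X C).

(** For a positive operator [A], the composite lies between 0 and [A] on the cone; the general case
    follows by differences. *)
Lemma sandwich_regular T : B \o T \o C \in @regular_pred R X.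
Proof.
have [Bl _ B0 BI] := B_band; have [Cl _ C0 CI] := C_band.
have pos (A : regular_operator X) : 0 <=v A -> B \o A \o C \in @regular_pred R X.
  move=> A0; apply: (@dominated_regular _ A) => [a x y|x x0|x x0] /=.
  - by rewrite Cl regular_linear Bl.
  - exact/B0/A0/C0.
  - apply: (vle_trans (A (C x))); first exact/BI/A0/C0.
    by apply: positive_linear_homo => //; [exact: regular_linear|exact: CI].
have [U [V [U0 V0 ->]]] := regular_generating T.
have -> : B \o (U - V : regular_operator X) \o C = (B \o U \o C) - (B \o V \o C).
  by apply/funext => x; exact: (linear_funB B Bl (U (C x)) (V (C x))).
by apply: rpredB; exact: pos.
Qed.

Definition sandwich T : regular_operator X := RegularOperator (sandwich_regular T).

Lemma sandwich_band : band_projection (regular_operator X) sandwich.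
Proof.
have [Bl BB B0 BI] := B_band; have [Cl CC C0 CI] := C_band.
split=> [a S T||T T0 x x0|T T0 x x0].
- by apply/val_inj/funext => x; exact: Bl.
- apply/funext => T; apply/val_inj/funext => x /=.
  by rewrite !(@band_projection_idem _ X).
- exact/B0/T0/C0.
- apply: (vle_trans (T (C x))); first exact/BI/T0/C0.
  by apply: positive_linear_homo => //; [exact: regular_linear|exact: CI].
Qed.

End Sandwich.

End BanachLatticeFacts.

(** * Sublinear functionals *)

Section HahnBanach.
Context {R : realType} {V : lmodType R}.
Implicit Types (p q : V -> R) (x y z : V).

(* Positive homogeneity follows: apply the inequality to both t and 1 / t. *)
Definition sublinear p := (forall x y, p (x + y) <= p x + p y) /\
  (forall (t : R) x, 0 < t -> p (t *: x) <= t * p x).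

Lemma sublinearZ p (t : R) x : sublinear p -> 0 < t -> p (t *: x) = t * p x.
Proof.
move=> [_ pZ] t0; apply/eqP; rewrite eq_le pZ//= -ler_pdivlMl//.
by rewrite -{1}[x](scalerK (lt0r_neq0 t0)) pZ// invr_gt0.
Qed.

Lemma sublinear0 p : sublinear p -> p 0 = 0.
Proof.
move=> hp; have := sublinearZ 0 hp (ltr0n R 2); rewrite scaler0 => /eqP.
by rewrite mulr_natl mulr2n -subr_eq0 opprD addNKr oppr_eq0 => /eqP.
Qed.

Lemma sublinear_oppr_le p x : sublinear p -> - p (- x) <= p x.
Proof. by move=> hp; rewrite -subr_ge0 opprK -(sublinear0 hp) -(subrr x); case: hp. Qed.

(** For [p] sublinear, this is the largest sublinear functional below [p] whose value at [- y] is at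
    most [- p y]. *)
Definition shift_inf p y x :=
  inf [set p (x + t *: y) - t * p y | t in [set t : R | 0 <= t]].

Section Shift.
Context {p : V -> R} (p_sub : sublinear p) (y : V).

Lemma shift_inf_le x (t : R) : 0 <= t -> shift_inf p y x <= p (x + t *: y) - t * p y.
Proof.
move=> t0; apply: ge_inf; last by exists t.
(* The set is bounded below, since [s * p y = p (s *: y) <= p (- x) + p (x + s *: y)]. *)
exists (- p (- x)) => _ [s /= s0 <-]; rewrite lerBrDr addrC lerBlDr.
have -> : s * p y = p (s *: y).
  move: s0; rewrite le_eqVlt => /predU1P[<-|s0]; last by rewrite sublinearZ.
  by rewrite mul0r scale0r sublinear0.
have [pD _] := p_sub; rewrite -{1}[s *: y](addKr x) [leRHS]addrC.
exact: pD.
Qed.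

Lemma le_shift_inf x (c : R) :
  (forall t, 0 <= t -> c <= p (x + t *: y) - t * p y) -> c <= shift_inf p y x.
Proof.
move=> hc; apply: lb_le_inf => [|_ [t t0 <-]]; last exact: hc.
by exists (p (x + 0 *: y) - 0 * p y); exists 0 => /=.
Qed.

(** Parameters for the two summands are added, and a parameter for [x] is multiplied by [s] to serve
    [s *: x]. *)
Lemma shift_inf_sublinear : sublinear (shift_inf p y).
Proof.
have [pD pZ] := p_sub; split=> [x z|s x s0].
  rewrite -lerBlDr; apply: le_shift_inf => t t0.
  rewrite lerBlDr [leRHS]addrC -lerBlDr; apply: le_shift_inf => s' s'0.
  rewrite lerBlDr; apply: le_trans (shift_inf_le _ (addr_ge0 s'0 t0)) _.
  rewrite [leRHS]addrACA -opprD -mulrDl lerD2r scalerDl [x + z]addrC addrACA.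
  exact: pD.
rewrite -ler_pdivrMl//; apply: le_shift_inf => t t0.
rewrite ler_pdivrMl//; apply: le_trans (shift_inf_le _ (mulr_ge0 (ltW s0) t0)) _.
by rewrite -scalerA -scalerDr sublinearZ// mulrBr mulrA.
Qed.

Lemma shift_inf_le_self x : shift_inf p y x <= p x.
Proof. by have := shift_inf_le x (lexx 0); rewrite scale0r addr0 mul0r subr0. Qed.

Lemma shift_inf_opp : shift_inf p y (- y) <= - p y.
Proof.
by have := shift_inf_le (- y) ler01; rewrite scale1r addNr mul1r sublinear0// sub0r.
Qed.

End Shift.

(* A minimal sublinear functional p equals its shifts [shift_inf p y], which
   makes it superadditive. *)
Lemma minimal_sublinear_linear p : sublinear p ->
  (forall q, sublinear q -> (forall x, q x <= p x) -> q = p) ->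
  forall (a : R) x y, p (a *: x + y) = a * p x + p y.
Proof.
move=> hp pmin.
have pD x y : p (x + y) = p x + p y.
  apply/eqP; rewrite eq_le; apply/andP; split; first by case: hp.
  rewrite -lerBrDr -{1}(pmin (shift_inf p y)).
  - by have := shift_inf_le hp y x ler01; rewrite scale1r mul1r.
  - exact: shift_inf_sublinear.
  - exact: shift_inf_le_self.
have pN x : p (- x) = - p x.
  by apply/eqP; rewrite -addr_eq0 -pD addNr sublinear0.
move=> a x y; rewrite pD; congr (_ + _).
have [a0|a0|->] := ltrgt0P a; first exact: sublinearZ.
  by rewrite -[a]opprK scaleNr pN sublinearZ ?oppr_gt0// !mulNr.
by rewrite scale0r mul0r sublinear0.
Qed.

Lemma exists_linear_below p : sublinear p -> exists f : V -> R,
  (forall (a : R) x y, f (a *: x + y) = a * f x + f y) /\ (forall x, f x <= p x).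
Proof.
move=> hp; pose T := {q : V -> R | sublinear q /\ forall x, q x <= p x}.
(* The order is reversed: a maximal element for [rel_le] is a minimal sublinear functional. *)
pose rel_le (q r : T) := `[< forall x, sval r x <= sval q x >].
have [|q1 q2 q3 /asboolP q12 /asboolP q23|q r /asboolP qr /asboolP rq|A Atot|[q [hq qp]] qmin]
    := @Zorn T rel_le.
- by move=> q; apply/asboolP.
- by apply/asboolP => x; exact: le_trans (q23 x) (q12 x).
- by apply: eq_sig_hprop => //; apply/funext => x; apply/eqP; rewrite eq_le qr rq.
- have [[q0 Aq0]|A0] := pselect (A !=set0); last first.
    (* The empty chain is bounded by [p] itself. *)
    exists (exist _ p (conj hp (fun=> lexx _))) => q Aq.
    by exfalso; apply: A0; exists q.
  pose m x := inf [set sval q x | q in A].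
  have m_le (q : T) x : A q -> m x <= sval q x.
    move=> Aq; apply: ge_inf; last by exists q.
    exists (- p (- x)) => _ [[r [hr rp]] _ <-] /=.
    by apply: le_trans (sublinear_oppr_le x hr); rewrite lerN2.
  have le_m x c : (forall q : T, A q -> c <= sval q x) -> c <= m x.
    move=> hc; apply: lb_le_inf => [|_ [q Aq <-]]; last exact: hc.
    by exists (sval q0 x); exists q0.
  have hm : sublinear m.
    split=> [x y|t x t0].
      rewrite -lerBlDr; apply: (le_m) => q Aq; rewrite lerBlDr [leRHS]addrC -lerBlDr.
      apply: (le_m) => r Ar; rewrite lerBlDr.
      (* In a chain one of [q] and [r] is the smaller; taken to be [r], its subadditivity alone
         gives the bound. *)
      wlog : x y q r Aq Ar / rel_le q r => [hwlog|/asboolP qr].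
        have [|] := Atot _ _ Aq Ar; first exact: hwlog.
        by move=> rq; rewrite addrC [leRHS]addrC; exact: hwlog rq.
      have [[rD _] _] := svalP r.
      apply: le_trans (m_le _ _ Ar) _; apply: le_trans (rD _ _) _.
      by rewrite addrC lerD2l.
    rewrite -ler_pdivrMl//; apply: (le_m) => q Aq; rewrite ler_pdivrMl//.
    have [[_ qZ] _] := svalP q.
    by apply: le_trans (m_le _ _ Aq) _; exact: qZ.
  have mp x : m x <= p x.
    by apply: le_trans (m_le _ x Aq0) _; have [_] := svalP q0; exact.
  by exists (exist _ m (conj hm mp)) => q Aq; apply/asboolP => x; exact: m_le.
exists q; split=> //; apply: minimal_sublinear_linear => // r hr rq.
have rp x : r x <= p x by exact: le_trans (rq x) (qp x).
have /qmin /(congr1 sval) // : rel_le (exist _ q (conj hq qp)) (exist _ r (conj hr rp)).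
exact/asboolP.
Qed.

(** A linear functional below [shift_inf p y] satisfies [f (- y) <= - p y], which is the last
    inequality. *)
Lemma hahn_banach_point p y : sublinear p -> exists f : V -> R,
  [/\ forall (a : R) x z, f (a *: x + z) = a * f x + f z,
      forall x, f x <= p x & p y <= f y].
Proof.
move=> hp; have [f [fl fp]] := exists_linear_below (shift_inf_sublinear hp y).
exists f; split=> // [x|]; first exact: le_trans (fp x) (shift_inf_le_self hp y x).
have f0 : f 0 = 0 by have := fl (-1) 0 0; rewrite scaler0 addr0 mulN1r addNr.
have fN : f (- y) = - f y by have := fl (-1) y 0; rewrite scaleN1r !addr0 f0 mulN1r addr0.
by rewrite -lerN2 -fN; exact: le_trans (fp _) (shift_inf_opp hp y).
Qed.

End HahnBanach.

(** * Inner band projections *)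

Section PositiveFunctional.
Context {R : realType} {X : banachLatticeType R}.
Implicit Types (x y : X) (B C : X -> X).

Lemma norm_le_pos x y : 0 <=v x -> x <=v y -> `|x| <= `|y|.
Proof.
move=> x0 xy; apply: norm_le_vabs; apply/vjoinP; split=> //.
apply: (vle_trans 0); last exact: vle_trans xy.
by apply/subv_ge0; rewrite opprK add0r.
Qed.

Lemma norm_pos_part_sublinear : sublinear (fun x => `|vjoin x 0|).
Proof.
split=> [x y|t x t0].
  apply: le_trans (ler_normD _ _).
  have [xx x0] := vjoin_ub x 0; have [yy y0] := vjoin_ub y 0.
  apply: norm_le_pos; first by have [] := vjoin_ub (x + y) 0.
  by apply/vjoinP; split; [exact: vleD|exact: addv_ge0].
rewrite -[leRHS](@ger0_norm _ (t * _)) ?mulr_ge0 ?(ltW t0)// normrM normr_id -normrZ.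
have [xx x0] := vjoin_ub x 0.
apply: norm_le_pos; first by have [] := vjoin_ub (t *: x) 0.
by apply/vjoinP; split; [apply: vleZ => //|apply: scalev_ge0 => //]; exact: ltW.
Qed.

(** Hahn-Banach is applied to the norm of the positive part: it vanishes at [- x] for positive [x],
    which gives positivity; it is at most the norm, which gives continuity; and it is positive at
    [y]. *)
Lemma exists_positive_functional y : 0 <=v y -> y <> 0 -> exists f : X -> R,
  [/\ forall (a : R) x z, f (a *: x + z) = a * f x + f z, continuous f,
      forall x, 0 <=v x -> 0 <= f x & f y != 0].
Proof.
move=> y0 yN0; have [f [fl fp fy]] := hahn_banach_point y norm_pos_part_sublinear.
have f0 : f 0 = 0 by have := fl (-1) 0 0; rewrite scaler0 addr0 mulN1r addNr.
have fN x : f (- x) = - f x.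
  by have := fl (-1) x 0; rewrite scaleN1r !addr0 f0 mulN1r addr0.
have f_norm x : f x <= `|x|.
  apply: le_trans (fp x) _; rewrite -(norm_vabs x).
  apply: norm_le_pos; first by have [] := vjoin_ub x 0.
  apply/vjoinP; split; last exact: vabs_ge0.
  by have [] := vjoin_ub x (- x).
exists f; split=> // [|x x0|].
- pose flin : {linear X -> R} := HB.pack f (GRing.isLinear.Build R X R _ f fl).
  apply: (@bounded_linear_continuous R X R flin).
  apply/linear_boundedP; near=> r => x.
  apply: (le_trans (y := `|x|)); last first.
    by apply: ler_peMl => //; near: r; exact: nbhs_pinfty_ge.
  by rewrite ler_norml f_norm lerNl -fN -(normrN x) f_norm.
- rewrite -oppr_le0 -fN; apply: le_trans (fp _) _.
  suff -> : vjoin (- x) 0 = 0 by rewrite normr0.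
  apply: vle_anti; last by have [] := vjoin_ub (- x) 0.
  apply/vjoinP; split; last exact: vle_refl.
  by apply/subv_ge0; rewrite opprK add0r.
- rewrite gt_eqF//; apply: lt_le_trans fy; rewrite normr_gt0.
  apply/eqP => yy; apply: yN0; apply: vle_anti => //.
  by rewrite -{1}yy; have [] := vjoin_ub y 0.
Unshelve. all: by end_near. Qed.

Lemma band_projection_neq0 B : band_projection X B -> B <> (fun=> 0) ->
  exists x, [/\ 0 <=v x, x <> 0 & B x = x].
Proof.
move=> Bb BN0; apply: contrapT => noB; apply: BN0.
have [Bl _ _ _] := Bb; have [zl _ _ _] := @band_projection0 R X.
apply: (linear_eq_on_cone banach_lattice_generating) => // x x0.
apply: contrapT => BxN0; apply: noB; exists (B x); split=> //.
  exact: band_projection_ge0.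
exact: band_projection_idem.
Qed.

(* B T C is nonzero for a suitable rank one operator T. *)
Lemma sandwich_neq0 B C (Bb : band_projection X B) (Cb : band_projection X C) :
  B <> (fun=> 0) -> C <> (fun=> 0) -> sandwich Bb Cb <> (fun=> 0).
Proof.
move=> BN0 CN0 BTC0.
have [x [x0 xN0 Bx]] := band_projection_neq0 Bb BN0.
have [y [y0 yN0 Cy]] := band_projection_neq0 Cb CN0.
have [f [fl fc f0 fyN0]] := exists_positive_functional y0 yN0.
have Treg : (fun z => f z *: x) \in @regular_pred R X.
  apply: positive_operator_regular; split=> [a u v|z|z z0].
  - by rewrite fl scalerDl scalerA.
  - by apply: cvgZl; exact: fc.
  - by apply: scalev_ge0 => //; exact: f0.
have /(congr1 (fun S : regular_operator X => S y)) /= :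
  sandwich Bb Cb (RegularOperator Treg) = 0 by rewrite BTC0.
have [Bl _ _ _] := Bb.
rewrite Cy linear_funZ// Bx => /eqP; rewrite scaler_eq0 (negbTE fyN0) /=.
by move/eqP.
Qed.

End PositiveFunctional.

(** * Inner projections as suprema of sandwich projections *)

Section InnerProjectionFacts.
Context {R : realType} {X : banachLatticeType R} {L : Type} {P : L -> X -> X}.
Hypothesis X_dc : dedekind_complete X.
Hypothesis P_band : forall l, band_projection X (P l).
Hypothesis P_disj : forall l m, l <> m -> P l \o P m = (fun=> 0).

Let Lr := regular_operator X.
Let Q (i : L * L) : Lr -> Lr := sandwich (P_band i.1) (P_band i.2).

(** The composite is [P a P c T P d P b]; distinct pairs differ in a left or a right index, so
    [P a P c] or [P d P b] vanishes. *)
Lemma inner_sandwich_disj i j : i <> j -> forall T, Q i (Q j T) = 0.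
Proof.
case: i j => [a b] [c d] ij T; apply/val_inj/funext => x /=.
have P0 l m z : l <> m -> P l (P m z) = 0.
  by move=> /P_disj /(congr1 (@^~ z)).
have [ac|ac] := pselect (a = c); last exact: P0.
have bd : d <> b by move=> db; apply: ij; rewrite ac db.
have [Pal _ _ _] := P_band a; have [Pcl _ _ _] := P_band c.
by rewrite (P0 d b)// (linear_fun0 (regular_linear T)) !linear_fun0.
Qed.

Definition inner_sup : set (L * L) -> Lr -> Lr :=
  band_sup (@regular_generating R X) (fun i => sandwich_band (P_band i.1) (P_band i.2))
    inner_sandwich_disj (regular_directed_complete X_dc).

Lemma inner_familyE G T : inner_family P G T = [set Q i T | i in G].
Proof.
apply/seteqP; split=> [S [a [b [Gab SE]]]|_ [[a b] Gab <-]]; last by exists a, b.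
by exists (a, b) => //; exact/val_inj/esym.
Qed.

(** The map [inner_sup G] satisfies [inner_spec], so the default of [xget] is never taken; any other
    solution has the same suprema on the cone, which generates. *)
Lemma inner_projectionE : inner_projection P = inner_sup.
Proof.
apply/funext => G; apply: xget_unique => [|B [Bb BG]].
  split=> [|T T0]; first exact: band_sup_band.
  split=> [->|G0]; first by rewrite /inner_sup band_sup_set0.
  by rewrite inner_familyE; exact: band_sup_sup.
have [Bl _ _ _] := Bb; have [Sl _ _ _] : band_projection Lr (inner_sup G).
  exact: band_sup_band.
apply: (linear_eq_on_cone (@regular_generating R X)) => // T T0.
have [B0 Bsup] := BG T T0.
have [G0|/set0P G0] := eqVneq G set0.
  by rewrite B0// G0 /inner_sup band_sup_set0.
apply: vle_sup_unique (Bsup G0) _.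
by rewrite inner_familyE; exact: band_sup_sup.
Qed.

End InnerProjectionFacts.

Theorem proposition2p10 (R : realType) (X : banachLatticeType R)
    (X_dc : dedekind_complete X) (L : Type) (P : L -> X -> X)
    (P_band : forall l, band_projection X (P l))
    (P_disj : forall l m, l <> m -> P l \o P m = (fun=> 0)) :
  let Lr := regular_operator X in
  let inner_projections : set (Lr -> Lr) := range (inner_projection P) in
  let inner_bands : set (set Lr) := range (inner_band P) in
  [/\ is_boolean_algebra op_le inner_projections,
      same_sup_inf op_le inner_projections (band_projection Lr),
      boolean_morphism op_le inner_projections (inner_projection P) &
      (forall l, P l <> (fun=> 0)) ->
        boolean_isomorphism op_le inner_projections (inner_projection P)] /\
  [/\ is_boolean_algebra subset inner_bands,
      same_sup_inf subset inner_bands (projection_band Lr),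
      boolean_morphism subset inner_bands (inner_band P) &
      (forall l, P l <> (fun=> 0)) ->
        boolean_isomorphism subset inner_bands (inner_band P)].
Proof.
move=> Lr inner_projections inner_bands.
pose f := inner_projection P.
(* Some [P l] may vanish, so only indices with a nonzero sandwich count; in the isomorphism case
   these are all indices. *)
pose J := [set i : L * L | sandwich (P_band i.1) (P_band i.2) <> fun=> 0].
have fE : f = inner_sup X_dc P_band P_disj by exact: inner_projectionE.
have Lr_gen : generating_cone Lr by exact: regular_generating.
have f_band G : band_projection Lr (f G) by rewrite fE; exact: band_sup_band.
have le_refl (B : Lr -> Lr) : op_le B B by move=> T _; exact: vle_refl.
have le_anti := fun B C => @op_le_anti R Lr Lr_gen B C.
have f_sup K : is_sup op_le (band_projection Lr) (f @` K) (f (\bigcup_(G in K) G)).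
  by rewrite fE; exact: band_sup_bigcup.
have f_inf K : K !=set0 ->
    is_inf op_le (band_projection Lr) (f @` K) (f (\bigcap_(G in K) G)).
  by rewrite fE; exact: band_sup_bigcap.
have f_supp G : f (G `&` J) = f G by rewrite fE; exact: band_sup_support.
have f_reflect G H : op_le (f G) (f H) -> G `&` J `<=` H.
  by rewrite fE; exact: band_sup_reflect.
have J_full : (forall l, P l <> (fun=> 0)) -> J = setT.
  by move=> PN0; apply/seteqP; split=> // i _; exact: sandwich_neq0.
(* This is [inner_band P] unfolded. Taking ranges embeds the order of band projections into
   inclusion, so the properties of [f] carry over. *)
pose g G := range (f G).
have range_le (B C : Lr -> Lr) : band_projection Lr B -> band_projection Lr C ->
  range B `<=` range C <-> op_le B C by exact: range_subset_op_le.
have image_g K : g @` K = (fun B : Lr -> Lr => range B) @` (f @` K).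
  by rewrite image_comp.
have sub_band K : f @` K `<=` band_projection Lr by move=> _ [G _ <-].
have g_sup K : is_sup subset (projection_band Lr) (g @` K) (g (\bigcup_(G in K) G)).
  by rewrite image_g; exact: (embedding_is_sup range_le (sub_band K) (f_sup K)).
have g_inf K : K !=set0 ->
    is_inf subset (projection_band Lr) (g @` K) (g (\bigcap_(G in K) G)).
  by move=> K0; rewrite image_g; exact: (embedding_is_inf range_le (sub_band K) (f_inf K K0)).
have g_supp G : g (G `&` J) = g G by rewrite /g f_supp.
have g_reflect G H : g G `<=` g H -> G `&` J `<=` H.
  by move=> /range_le GH; apply: f_reflect; exact: GH.
have sub_anti (A B : set Lr) : projection_band Lr A -> projection_band Lr B ->
    A `<=` B -> B `<=` A -> A = B by move=> _ _ AB BA; apply/seteqP.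
split; split.
- exact: (powerset_family_boolean le_refl f_sup f_supp f_reflect).
- exact: (powerset_family_same_sup_inf le_anti f_sup f_inf).
- exact: (powerset_family_morphism f_sup f_inf).
- move=> /J_full JT; apply: (powerset_family_isomorphism le_refl f_sup f_inf) => G H.
  by move=> /f_reflect; rewrite JT setIT.
- exact: (powerset_family_boolean (@subset_refl Lr) g_sup g_supp g_reflect).
- exact: (powerset_family_same_sup_inf sub_anti g_sup g_inf).
- exact: (powerset_family_morphism g_sup g_inf).
- move=> /J_full JT.
  apply: (powerset_family_isomorphism (@subset_refl Lr) g_sup g_inf) => G H.
  by move=> /g_reflect; rewrite JT setIT.
Qed.
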